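(* Let $a,b,r,s,t,u,p,q,v,w$ be indeterminates. Define monic polynomials $p_n(x)$ by $p_{-1}(x)=0$, $p_0(x)=1$ and $$p_{n+1}(x)=(x-b_n)p_n(x)-\lambda_n p_{n-1}(x)\quad(n\ge 0),$$ where $b_n=a[n+1]_{r,s}+b[n]_{t,u}$ and $\lambda_n=ab[n]_{p,q}[n]_{v,w}$. Let $\mathcal L$ be the unique linear functional on polynomials in $x$ (with coefficients rational functions in the parameters) such that $\mathcal L(1)=1$ and $\mathcal L(p_n)=0$ for all $n\ge1$, and let $\mu_n=\mathcal L(x^n)$ be its $n$-th moment. Then for every $n\ge 0$, $$\mu_n=\sum_{\sigma\in S_n} r^{\mathrm{lsg(sing)}(\sigma)}s^{\mathrm{rsg(sing)}(\sigma)}t^{\mathrm{lsg(cont)}(\sigma)}u^{\mathrm{rsg(cont)}(\sigma)}p^{\mathrm{lsg(op)}(\sigma)}q^{\mathrm{rsg(op)}(\sigma)}v^{\mathrm{lsg(clos)}(\sigma)}w^{\mathrm{rsg(clos)}(\sigma)}a^{\mathrm{run}(\sigma)}b^{\,n-\mathrm{run}(\sigma)}.$$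
   Context: Notation: $[n]_{r,s}=\frac{r^n-s^n}{r-s}=r^{n-1}+r^{n-2}s+\dots+s^{n-1}$ (so $[0]_{r,s}=0$). A permutation $\sigma\in S_n$ is written as the word $\sigma(1)\sigma(2)\cdots\sigma(n)$. Its runs are the maximal contiguous increasing segments $\sigma(i)<\sigma(i+1)<\dots<\sigma(j)$ of this word; $\mathrm{run}(\sigma)$ denotes the number of runs (equal to the number of descents plus one). A run of length at least 2 is a proper run; a run of length 1 is a singleton run. The values of $\sigma$ are split into four classes: $\mathrm{op}(\sigma)$ = first elements of proper runs (openers), $\mathrm{clos}(\sigma)$ = last elements of proper runs (closers), $\mathrm{sing}(\sigma)$ = elements forming singleton runs, $\mathrm{cont}(\sigma)$ = all other elements (continuators). For $i\in\{1,\dots,n\}$, $\mathrm{lsg}(i)$ is the number of runs of $\sigma$ lying strictly to the left of $i$ (i.e. not containing $i$ and positioned before it) that contain both an element smaller than $i$ and an element greater than $i$; $\mathrm{rsg}(i)$ is the analogous number of runs strictly to the right of $i$. For a class $X\in\{\mathrm{op},\mathrm{clos},\mathrm{sing},\mathrm{cont}\}$, $\mathrm{lsg}(X)(\sigma)=\sum_{i\in X(\sigma)}\mathrm{lsg}(i)$ and $\mathrm{rsg}(X)(\sigma)=\sum_{i\in X(\sigma)}\mathrm{rsg}(i)$. *)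

(* Defs.v *)
From HB Require Import structures.
From mathcomp Require Import all_boot all_order all_algebra all_fingroup.
Set Implicit Arguments. Unset Strict Implicit. Unset Printing Implicit Defensive.
Import GRing.Theory.
Local Open Scope ring_scope.

Definition qint (R : comNzRingType) (r s : R) (n : nat) : R :=
  \sum_(i < n) r ^+ (n.-1 - i) * s ^+ i.

Section OP.
Variables (R : comNzRingType) (a b r s t u p q v w : R).

Definition bcoef (n : nat) : R := a * qint r s n.+1 + b * qint t u n.
Definition lcoef (n : nat) : R := a * b * qint p q n * qint v w n.

(* ppair n = (p_{n-1}, p_n) *)
Fixpoint ppair (n : nat) : {poly R} * {poly R} :=
  match n with
  | 0 => (0, 1)
  | m.+1 => let: (pm, pc) := ppair m in
            (pc, ('X - (bcoef m)%:P) * pc - (lcoef m)%:P * pm)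
  end.

Definition opoly (n : nat) : {poly R} := (ppair n).2.
End OP.

Definition Lfun (R : comNzRingType) (mu : nat -> R) (P : {poly R}) : R :=
  \sum_(i < size P) P`_i * mu i.

(* Statistics on a word w (= sigma(1) ... sigma(n), positions 0..n-1) *)
Section Word.
Variable w : seq nat.

Definition rstart (i : nat) : bool := (i == 0)%N || (nth 0%N w i.-1 > nth 0%N w i)%N.
Definition rend (i : nat) : bool := (i.+1 == size w)%N || (nth 0%N w i > nth 0%N w i.+1)%N.
(* position m lies in the run starting at position k (k a run start) *)
Definition inrun (k m : nat) : bool :=
  [&& (k <= m)%N, (m < size w)%N & all (fun l => ~~ rstart l) (iota k.+1 (m - k))].
Definition positions := iota 0 (size w).
Definition straddles (k j : nat) : bool :=
  has (fun m => inrun k m && (nth 0%N w m < nth 0%N w j)%N) positions &&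
  has (fun m => inrun k m && (nth 0%N w m > nth 0%N w j)%N) positions.
Definition lsg (j : nat) : nat :=
  count (fun k => [&& rstart k, (k < j)%N, ~~ inrun k j & straddles k j]) positions.
Definition rsg (j : nat) : nat :=
  count (fun k => [&& rstart k, (j < k)%N & straddles k j]) positions.

Definition nruns : nat := count rstart positions.

(* classes (by position; positions and values are in bijection) *)
Definition is_sing j := rstart j && rend j.
Definition is_op j := rstart j && ~~ rend j.
Definition is_clos j := ~~ rstart j && rend j.
Definition is_cont j := ~~ rstart j && ~~ rend j.

Definition lsgX (X : nat -> bool) : nat := sumn [seq lsg j | j <- positions & X j].
Definition rsgX (X : nat -> bool) : nat := sumn [seq rsg j | j <- positions & X j].
End Word.

Definition word (n : nat) (sg : 'S_n) : seq nat := [seq val (sg i) | i <- enum 'I_n].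

Definition weight (R : comNzRingType) (a b r s t u p q v w : R) (n : nat) (sg : 'S_n) : R :=
  let x := word sg in
  r ^+ lsgX x (is_sing x) * s ^+ rsgX x (is_sing x) *
  t ^+ lsgX x (is_cont x) * u ^+ rsgX x (is_cont x) *
  p ^+ lsgX x (is_op x) * q ^+ rsgX x (is_op x) *
  v ^+ lsgX x (is_clos x) * w ^+ rsgX x (is_clos x) *
  a ^+ nruns x * b ^+ (n - nruns x).

(* Main.v *)
Require Import Defs.
From HB Require Import structures.
From mathcomp Require Import all_boot all_order all_algebra all_fingroup.
From mathcomp Require Import zify ring.
Import GRing.Theory.
Local Open Scope ring_scope.

(* Build a permutation by inserting its letters in increasing order. The letters
   smaller than [i] form a word cut into blocks, the traces of the runs; a block
   is open if its run will receive further letters. Two consecutive closed blocks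
   are separated by a descent, so [i] can only start a new block at the front of
   the word or right after an open block, or else prolong an open block. With [k]
   open blocks, the statistics of [i] then add up to [k] or [k - 1] and take every
   value once, which gives the weights [a[k+1]_{p,q}], [a[k+1]_{r,s}],
   [b[k]_{t,u}] and [b[k]_{v,w}] for an opener, a singleton, a continuator and a
   closer. The permutations are thus weighted Motzkin paths with [k] as height.
   On the other side, the three-term recurrence shows that [L(x^n p_k)] is the
   weight of the paths of length [n] from height [k] to [0], times
   [prod_{j <= k} a[j]_{p,q}]. *)

(** * Marked words *)

(* A marked letter is the current end of an open block. *)
Definition mword := seq (nat * bool).

Definition nmarks (y : mword) : nat := count snd y.

(** If [e] keeps its mark, [i] starts a block behind it; otherwise [i] prolongs the block of [e]. In
    order: opener, singleton, continuator, closer. *)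
Fixpoint insert_after_mark (i : nat) (y : mword) : seq mword :=
  if y is e :: y' then
    (if e.2 then [:: (e.1, true) :: (i, true) :: y'; (e.1, true) :: (i, false) :: y';
                     (e.1, false) :: (i, true) :: y'; (e.1, false) :: (i, false) :: y']
     else [::]) ++ map (cons e) (insert_after_mark i y')
  else [::].

Definition insertions (i : nat) (y : mword) : seq mword :=
  [:: (i, true) :: y, (i, false) :: y & insert_after_mark i y].

Fixpoint mwords (n : nat) : seq mword :=
  if n is m.+1 then [seq y' | y <- mwords m, y' <- insertions m y] else [:: [::]].

(* Deleting the tail [i] of a block of size at least two leaves that block open. *)
Fixpoint delete (i : nat) (y : mword) : mword :=
  if y is e :: y' then
    if e.1 == i then y'
    else (e.1, e.2 || (ohead (unzip1 y') == Some i)) :: delete i y'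
  else [::].

(** Deletion marks the predecessor of [i] again, whether or not insertion removed that mark, so it
    undoes all four choices. The last conjunct leaves out [i] at the front, which [insertions]
    treats apart. *)
Lemma insert_after_mark_delete i (y y' : mword) :
  i \notin unzip1 y ->
  (y' \in insert_after_mark i y) =
  [&& delete i y' == y, count_mem i (unzip1 y') == 1%N & ohead (unzip1 y') != Some i].
Proof.
elim: y y' => [|[c m] y IH] y' /=.
  move=> _; rewrite in_nil; case: y' => [|[c' m'] y'] //=.
  have [->|//] := eqVneq c' i.
  by rewrite eqxx !andbF.
rewrite in_cons negb_or => /andP[ci iy].
have cNi : (c == i) = false by rewrite eq_sym; apply: negbTE.
have ctd z : i \notin unzip1 z -> count_mem i (unzip1 z) = 0%N.
  by move=> h; apply/count_memPn.
have delnot z : i \notin unzip1 z -> delete i z = z.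
  elim: z => [|[d k] z IHz] //=; rewrite in_cons negb_or eq_sym => /andP[/negbTE-> hz].
  rewrite (IHz hz); case: z hz {IHz} => [|[d' k'] z] /=; first by rewrite orbF.
  rewrite in_cons negb_or => /andP[h _].
  by rewrite (_ : (Some d' == Some i) = false) ?orbF //; apply/negbTE; rewrite eq_sym.
have step (d : nat) (k : bool) z : d != i ->
  (((d, k) :: z) \in map (cons (c, m)) (insert_after_mark i y)) =
  [&& d == c, k == m & z \in insert_after_mark i y].
  move=> _; apply/mapP/idP => [[z0 hz0 [-> -> ->]]|/and3P[/eqP-> /eqP-> hz]].
    by rewrite !eqxx.
  by exists z.
case: y' => [|[d k] z] /=.
  by rewrite mem_cat; case: m step => step /=; rewrite ?inE /=; apply/negbTE/mapP => -[].
have [->|dNi] := eqVneq d i.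
  rewrite eqxx !andbF mem_cat; apply/negbTE; rewrite negb_or; apply/andP; split.
    by case: m step => step; rewrite ?inE ?eqseq_cons ?xpair_eqE ?(eq_sym i) ?cNi.
  by apply/mapP => -[z0 _ [/eqP]]; rewrite eq_sym cNi.
have -> /= : (Some d == Some i) = false by apply/negbTE.
rewrite mem_cat step // add0n andbT eqseq_cons xpair_eqE.
rewrite IH //.
case: z step => [|[d' k'] z] step /=.
  by case: m step => step /=; rewrite ?inE ?eqseq_cons ?xpair_eqE ?andbF /= ?andbF.
(* If [i] comes second, only the four words created at [c] can match; otherwise only the recursive
   call can. *)
have [->|d'Ni] := eqVneq d' i.
  rewrite eqxx !andbF orbF orbT /=.
  case: m step => step /=; last by rewrite andbF.
  rewrite !inE !eqseq_cons !xpair_eqE eqxx /=.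
  rewrite addnC addn1 eqSS.
  have [->|zy] := eqVneq z y; last by rewrite !andbF.
  by rewrite ctd // eqxx; case: k; case: k'; case: (d == c).
have -> : (Some d' == Some i) = false by apply/negbTE.
rewrite orbF /= andbT.
suff -> : ((d, k) :: (d', k') :: z \in if m then
    [:: [:: (c, true), (i, true) & y]; [:: (c, true), (i, false) & y];
        [:: (c, false), (i, true) & y]; [:: (c, false), (i, false) & y]] else [::]) = false.
  by rewrite /= -!andbA.
case: m step => step //=.
by rewrite !inE !eqseq_cons !xpair_eqE (negbTE d'Ni) !andbF.
Qed.

(** A marked word thus has a single parent under insertion, its image under [delete i]. Completeness
    and uniqueness of the enumeration [mwords] both rest on this. *)
Lemma insertionsP i (y y' : mword) :
  i \notin unzip1 y ->
  (y' \in insertions i y) = (delete i y' == y) && (count_mem i (unzip1 y') == 1%N).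
Proof.
move=> iy; rewrite /insertions !inE insert_after_mark_delete //.
case: y' => [|[c m] y'] /=; first by case: y iy.
rewrite !eqseq_cons !xpair_eqE.
have [->|cNi] := eqVneq c i.
  rewrite eqxx !andbF orbF /= addnC addn1 eqSS.
  have [->|] := eqVneq y' y; last by rewrite !andbF.
  by rewrite (count_memPn iy); case: m.
by rewrite -(inj_eq (@Some_inj _)) in cNi; rewrite cNi !andbT.
Qed.

Lemma delete_perm i (y : mword) :
  i \in unzip1 y -> perm_eq (unzip1 y) (i :: unzip1 (delete i y)).
Proof.
elim: y => //= -[c m] y IH; rewrite in_cons /= [i == c]eq_sym.
case: (eqVneq c i) => [-> _ //|cNi iy] /=.
by rewrite (permPr (permEl (perm_catCA [:: i] [:: c] _))) /= perm_cons; apply: IH.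
Qed.

(** By induction, removing the largest letter. The marks are unconstrained: every marking of every
    arrangement is reached. *)
Lemma mem_mwords n (y : mword) :
  (y \in mwords n) = perm_eq (unzip1 y) (iota 0 n).
Proof.
elim: n y => [|n IH] y.
  by rewrite /= inE; case: y => //= e y; apply/esym/perm_nilP.
have nN (z : mword) : z \in mwords n -> n \notin unzip1 z.
  by rewrite IH => /perm_mem->; rewrite mem_iota add0n ltnn andbF.
have iotaSr : perm_eq (iota 0 n.+1) (n :: iota 0 n).
  by rewrite -addn1 iotaD add0n cats1 perm_rcons.
apply/flatten_mapP/idP => [[z hz]|hy].
  rewrite map_id insertionsP ?nN // => /andP[/eqP dz /eqP cy].
  rewrite (perm_trans (delete_perm n y _)) //; first by rewrite -has_pred1 has_count cy.
  by rewrite dz (permPr iotaSr) perm_cons -IH.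
have ny : n \in unzip1 y by rewrite (perm_mem hy) mem_iota add0n ltnS leqnn.
have hd : delete n y \in mwords n.
  by rewrite IH -(perm_cons n) -(permPr iotaSr) -(permPl (delete_perm n y ny)).
exists (delete n y) => //; rewrite map_id insertionsP ?nN // eqxx /=.
by rewrite (seq.permP hy (pred1 n)) (seq.permP iotaSr (pred1 n)) /= eqxx (count_memPn _) // mem_iota add0n ltnn andbF.
Qed.

Lemma uniq_insertions i (y : mword) : i \notin unzip1 y -> uniq (insertions i y).
Proof.
move=> iy; have N1 m : (i, m) :: y \notin insert_after_mark i y.
  by rewrite insert_after_mark_delete //= !eqxx /= ?andbF.
rewrite /insertions /= !inE (negbTE (N1 true)) (negbTE (N1 false)) eqseq_cons xpair_eqE andbF /=.
elim: y iy {N1} => [|[c m] y IH] //=; rewrite in_cons negb_or => /andP[ci iy].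
rewrite cat_uniq map_inj_uniq ?IH //; last by move=> ? ? [].
rewrite andbT; apply/andP; split.
  by case: m; rewrite //= !inE !eqseq_cons !xpair_eqE !andbF.
apply/hasPn => _ /mapP[z hz ->]; case: m => //=.
rewrite !inE !eqseq_cons !xpair_eqE.
move: hz; rewrite insert_after_mark_delete // => /and3P[_ _].
case: z => [|[d k] z]; rewrite /= ?eqseq_cons ?xpair_eqE ?andbF //.
by move=> neq; rewrite (negbTE (_ : d != i)) // andbF.
Qed.

Lemma uniq_mwords n : uniq (mwords n).
Proof.
elim: n => [|n IH] //=.
have nN (z : mword) : z \in mwords n -> n \notin unzip1 z.
  by rewrite mem_mwords => /perm_mem->; rewrite mem_iota add0n ltnn andbF.
apply: (@allpairs_uniq_dep mword (fun=> mword) mword (fun _ y => y) (mwords n) (insertions n)) => // [y /nN|]; first exact: uniq_insertions.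
move=> _ _ /allpairsPdep[y [z [hy hz ->]]] /allpairsPdep[y' [z' [hy' hz' ->]]] /= E.
move: hz hz'; rewrite E !insertionsP ?nN // => /andP[/eqP<- _] /andP[/eqP<- _].
by [].
Qed.

(** * Straddling runs and crossings *)

Section Runs.
Variable x : seq nat.

Lemma inrunP k m :
  reflect [/\ (k <= m)%N, (m < size x)%N & forall l, (k < l <= m)%N -> ~~ rstart x l]
          (inrun x k m).
Proof.
apply: (iffP and3P) => -[km mx /= H]; split=> //.
  move=> l hl; apply: (allP H); rewrite mem_iota; lia.
by apply/allP => l; rewrite mem_iota => hl; apply: H; lia.
Qed.

Fixpoint run_start (m : nat) : nat :=
  if m is m'.+1 then (if rstart x m then m else run_start m') else 0%N.

Lemma run_start_le m : (run_start m <= m)%N.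
Proof. by elim: m => //= m IH; case: ifP => // _; apply: leqW. Qed.

Lemma rstart_run_start m : rstart x (run_start m).
Proof. by elim: m => //= m IH; case: ifP. Qed.

Lemma inrun_run_start k m : rstart x k ->
  inrun x k m = (m < size x)%N && (run_start m == k).
Proof.
move=> hk; apply/inrunP/andP => [[km mx H]|[mx /eqP<-]]; split=> //.
- elim: m km H {mx} => [|m IH]; first by rewrite leqn0 => /eqP->.
  rewrite leq_eqVlt => /orP[/eqP<- _|]; first by case: k hk {IH} => //= k ->.
  rewrite ltnS => km H /=; rewrite (negbTE (H _ _)) ?ltnS ?km ?leqnn //.
  by apply: IH => // l hl; apply: H; lia.
- exact: run_start_le.
- elim: m {mx} => [|m IH] l /=; first by lia.
  case: ifP => [_|/negbT hm]; first by lia.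
  rewrite [(l <= _)%N]leq_eqVlt => /andP[h1 /orP[/eqP->//|h2]].
  by apply: IH; rewrite h1.
Qed.

Lemma inrun_monotone k m m' : uniq x -> inrun x k m' -> (k <= m < m')%N ->
  (nth 0%N x m < nth 0%N x m')%N.
Proof.
move=> ux /inrunP[_ + H]; elim: m' H => [|m' IH] H; first by rewrite andbF.
move=> m'x /andP[km]; rewrite ltnS => mm'.
have lt1 : (nth 0%N x m' < nth 0%N x m'.+1)%N.
  have := H m'.+1; rewrite /rstart /= => /(_ _)/[!leqnn]/[!andbT] /(_ (leq_trans km mm')).

  by rewrite -leqNgt leq_eqVlt nth_uniq ?ltn_eqF // ltnW.
case: (ltngtP m m') mm' => // [mm' _|-> _ //].
by apply: ltn_trans lt1; apply: IH => [l hl||]; [apply: H; lia|lia|lia].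
Qed.

Definition crossing (c l : nat) : bool := (nth 0%N x l < c < nth 0%N x l.+1)%N.

Lemma crossing_size c l : crossing c l -> (l.+1 < size x)%N.
(* Past the end [nth] returns 0, and nothing lies below 0. *)
Proof. by case: ltnP => // h /andP[_]; rewrite [nth _ _ _.+1]nth_default. Qed.

Lemma crossing_run c l : crossing c l -> run_start l.+1 = run_start l.
Proof.
move=> /andP[h1 h2] /=; rewrite /rstart /= ifN //.
by rewrite -leqNgt ltnW // (ltn_trans h1).
Qed.

(** A discrete intermediate value theorem; the last hypothesis keeps the value [c] itself off the
    segment. *)
Lemma crossing_between c m1 m2 : (m1 <= m2)%N -> (nth 0%N x m1 < c)%N ->
  (c < nth 0%N x m2)%N -> (forall m, c != nth 0%N x m \/ ~~ (m1 <= m <= m2)%N) ->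
  exists2 l, (m1 <= l < m2)%N & crossing c l.
Proof.
elim: m2 => [|m2 IH]; first by rewrite leqn0 => /eqP->; lia.
rewrite leq_eqVlt => /orP[/eqP->|]; first by lia.
rewrite ltnS => h h1 h2 H.
case: (ltngtP c (nth 0%N x m2)) => [h3|h3|h3].
- have [|l hl cl] := IH h h1 h3; last by exists l => //; lia.
  by move=> m; case: (H m); [left|right; lia].
- by exists m2; rewrite ?h ?leqnn // /crossing h3.
by case: (H m2); rewrite ?h3 ?eqxx //; lia.
Qed.

(* A run of [x] straddling [c] crosses [c] exactly once, so runs may be counted
   by their crossings. *)
Lemma count_runs_crossings (A B : pred nat) j : uniq x -> (j < size x)%N ->
  (forall l, crossing (nth 0%N x j) l -> A (run_start l) = B l) ->
  (forall k, rstart x k -> A k -> ~~ inrun x k j) ->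
  count (fun k => [&& rstart x k, A k & straddles x k j]) (positions x) =
  count (fun l => B l && crossing (nth 0%N x j) l) (positions x).
Proof.
move=> ux jx AB AN; set c := nth 0%N x j.
rewrite -!size_filter -[RHS](size_map run_start); apply: perm_size.
apply: uniq_perm; first exact/filter_uniq/iota_uniq.
  (* Two crossings [l < l'] in one run would give [c < x(l+1) <= x(l') < c]. *)
  rewrite map_inj_in_uniq ?filter_uniq ?iota_uniq // => l l'.
  rewrite !mem_filter => /andP[/andP[_ cl] _] /andP[/andP[_ cl'] _] rs.
  wlog lt_ll' : l l' cl cl' rs / (l < l')%N => [W|].
    by case: (ltngtP l l') => // [/(W l l')|/(W l' l)] -> //.
  have lx := crossing_size _ _ cl; have l'x := crossing_size _ _ cl'.
  have : (nth 0%N x l.+1 <= nth 0%N x l')%N.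
    move: lt_ll'; rewrite leq_eqVlt => /orP[/eqP->//|lt_ll']; apply: ltnW.
    apply: (@inrun_monotone (run_start l)) => //.
      by rewrite inrun_run_start ?rstart_run_start // rs eqxx ltnW.
    by rewrite lt_ll' (leq_trans (run_start_le l)).
  by move: cl cl'; rewrite /crossing; lia.
move=> k; rewrite mem_filter; apply/andP/mapP.
  move=> [/and3P[hk Ak /andP[/hasP[m1 _ /andP[r1 l1]] /hasP[m2 _ /andP[r2 l2]]]] _].
  (* The run increases, so its letter below [c] precedes the one above; [AN] keeps [c] itself off
     the run, hence a crossing in between. *)
  have m12 : (m1 <= m2)%N.
    rewrite leqNgt; apply/negP => lt; have /inrunP[km2 _ _] := r2.
    have := @inrun_monotone k m2 m1 ux r1; rewrite km2 lt => /(_ isT).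
    by move: l1 l2; lia.
  have /inrunP[km1 m1x _] := r1; have /inrunP[km2 m2x hm2] := r2.
  have [|l /andP[hl1 hl2] cl] := crossing_between c m1 m2 m12 l1 l2.
    move=> m; case: (boolP (m1 <= m <= m2)%N) => hm; [left|by right].
    have mx : (m < size x)%N by case/andP: hm => _ /leq_ltn_trans; apply.
    rewrite /c nth_uniq //.
    apply/eqP => jm; move/negP: (AN k hk Ak); apply; apply/inrunP; split=> //; first by lia.
    by move=> i hi; apply: hm2; lia.
  have rl : run_start l = k.
    apply/eqP; have : inrun x k l by apply/inrunP; split; [lia|lia|move=> i hi; apply: hm2; lia].
    by rewrite inrun_run_start // => /andP[].
  exists l => //; rewrite mem_filter -/c cl -AB // rl Ak mem_iota.
  by have := crossing_size _ _ cl; lia.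
case=> l; rewrite mem_filter => /andP[/andP[Bl cl] _] ->.
have lx := crossing_size _ _ cl.
have h0 := run_start_le l.
split; last by rewrite mem_iota; lia.
rewrite rstart_run_start AB // Bl /=; move: (cl) => /andP[c1 c2].
apply/andP; split; apply/hasP; [exists l | exists l.+1].
- by rewrite mem_iota; lia.
- by rewrite inrun_run_start ?rstart_run_start // eqxx c1 !andbT ltnW.
- by rewrite mem_iota; lia.
- by rewrite inrun_run_start ?rstart_run_start // (crossing_run _ _ cl) eqxx c2 lx.
Qed.

(** The run of position [j] increases through the value at [j], so no step of it jumps over that
    value. *)
Lemma crossing_run_neq j l : uniq x -> (j < size x)%N ->
  crossing (nth 0%N x j) l -> run_start l != run_start j.
Proof.
move=> ux jx cl; have lx := crossing_size _ _ cl; apply/negP => /eqP rs.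
have rj : inrun x (run_start l) j by rewrite inrun_run_start ?rstart_run_start // jx rs eqxx.
have rl : inrun x (run_start l) l by rewrite inrun_run_start ?rstart_run_start // ltnW ?eqxx.
have rl1 : inrun x (run_start l) l.+1.
  by rewrite inrun_run_start ?rstart_run_start // (crossing_run _ _ cl) lx eqxx.
have := run_start_le l; have := run_start_le j; rewrite -rs => h1 h2.
case/andP: cl => c1 c2.
case: (ltngtP j l) => [lt|lt|eq].
- by have := inrun_monotone _ _ _ ux rl; move=> /(_ j); lia.
- have [e|lt'] : (j = l.+1) \/ (l.+1 < j)%N by lia.
    by move: c2; rewrite e ltnn.
  by have := inrun_monotone _ _ _ ux rj; move=> /(_ l.+1); lia.
by move: c1; rewrite eq ltnn.
Qed.

Lemma run_start_mono l m : (l <= m)%N -> (run_start l <= run_start m)%N.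
Proof.
elim: m => [|m IH]; first by rewrite leqn0 => /eqP->.
rewrite leq_eqVlt => /orP[/eqP->//|]; rewrite ltnS => h /=.
by case: ifP => _; [have := run_start_le l; lia|apply: IH].
Qed.

(** If [j] lay between the start of the run of [l] and [l] itself, the two positions would share a
    run. *)
Lemma run_start_ltn j l : run_start l != run_start j -> (run_start l < j)%N = (l < j)%N.
Proof.
move=> ne; apply/idP/idP => h; last by have := run_start_le l; lia.
rewrite ltnNge; apply/negP => jl.
have h1 := run_start_mono _ _ jl; have h2 := run_start_le j.
have h3 := run_start_mono _ _ (ltnW h).
have idem : run_start (run_start l) = run_start l.
  by have := rstart_run_start l; case: (run_start l) => //= m ->.
by move: ne; rewrite idem in h3; lia.
Qed.

Lemma lsg_crossings j : uniq x -> (j < size x)%N ->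
  lsg x j = count (fun l => (l < j)%N && crossing (nth 0%N x j) l) (positions x).
Proof.
move=> ux jx.
rewrite -(@count_runs_crossings (fun k => (k < j)%N && ~~ inrun x k j)) //.
- by apply: eq_count => k; rewrite -andbA.
- move=> l cl; have ne := crossing_run_neq j l ux jx cl.
  rewrite inrun_run_start ?rstart_run_start // jx /= eq_sym ne andbT.
  exact: run_start_ltn.
by move=> k _ /andP[].
Qed.

Lemma rsg_crossings j : uniq x -> (j < size x)%N ->
  rsg x j = count (fun l => (j < l)%N && crossing (nth 0%N x j) l) (positions x).
Proof.
move=> ux jx.
rewrite -(@count_runs_crossings (fun k => (j < k)%N)) //.
- move=> l cl; have ne := crossing_run_neq j l ux jx cl.
  have lj : l != j by apply: contraNneq ne => ->.
  have rj : run_start l != j.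
    apply: contraNneq ne => e; rewrite -e.
    by have := rstart_run_start l; case: (run_start l) => //= m ->.
  by have := run_start_ltn _ _ ne; lia.
by move=> k _ jk; apply/negP => /inrunP[]; lia.
Qed.

End Runs.

(** * Moments and Motzkin paths *)

Section Functional.
Variables (R : comNzRingType) (mu : nat -> R).

Lemma Lfun_widen (P : {poly R}) m :
  (size P <= m)%N -> Lfun mu P = \sum_(i < m) P`_i * mu i.
Proof.
move=> le_P_m; rewrite /Lfun (big_ord_widen m (fun i => P`_i * mu i)) //.
rewrite big_mkcond; apply: eq_bigr => i _; case: ltnP => // le_P_i.
by rewrite nth_default ?mul0r.
Qed.

Lemma LfunD (P Q : {poly R}) : Lfun mu (P + Q) = Lfun mu P + Lfun mu Q.
Proof.
pose m := maxn (size P) (size Q).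
rewrite !(@Lfun_widen _ m) ?leq_maxl ?leq_maxr ?size_polyD // -big_split.
by apply: eq_bigr => i _; rewrite coefD mulrDl.
Qed.

Lemma LfunC (c : R) (P : {poly R}) : Lfun mu (c%:P * P) = c * Lfun mu P.
Proof.
rewrite mul_polyC (@Lfun_widen (c *: P) (size P)) ?size_scale_leq // mulr_sumr.
by apply: eq_bigr => i _; rewrite coefZ mulrA.
Qed.

Lemma Lfun_Xn n : Lfun mu 'X^n = mu n.
Proof.
rewrite /Lfun size_polyXn big_ord_recr /= coefXn eqxx mul1r.
by rewrite big1 ?add0r // => i _; rewrite coefXn ltn_eqF ?mul0r.
Qed.

End Functional.

Section Moments.
Variables (R : comNzRingType) (a b r s t u p q v w : R).
Let P := opoly a b r s t u p q v w.
Let bc := bcoef a b r s t u.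

Lemma qint0 (x y : R) : qint x y 0 = 0.
Proof. by rewrite /qint big_ord0. Qed.

(* At [k = 0] the predecessor [k.-1] is junk, but its coefficient [0]_{p,q} vanishes. *)
Lemma opoly_mulX k :
  'X * P k = P k.+1 + (bc k)%:P * P k + (lcoef a b p q v w k)%:P * P k.-1.
Proof.
have E : P k.+1 = ('X - (bc k)%:P) * P k -
   (lcoef a b p q v w k)%:P * (ppair a b r s t u p q v w k).1.
  by rewrite /P /opoly /=; case: (ppair a b r s t u p q v w k).
rewrite E; case: k {E} => [|k] /=.
  by rewrite /lcoef !qint0; ring.
have -> : (ppair a b r s t u p q v w k.+1).1 = P k.
  by rewrite /P /opoly /=; case: (ppair a b r s t u p q v w k).
by rewrite -/(P k.+1) /=; ring.
Qed.

(* [H k] stands for the weight of the continuations of a path at height [k]; as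
   above, the junk [k.-1] at [k = 0] carries the coefficient 0. *)
Definition path_step (H : nat -> R) (k : nat) : R :=
  a * qint p q k.+1 * H k.+1 + bc k * H k + b * qint v w k * H k.-1.

Lemma moment_paths (mu : nat -> R) :
  mu 0%N = 1 -> (forall n, (0 < n)%N -> Lfun mu (P n) = 0) ->
  forall n, mu n = iter n path_step (fun k => (k == 0)%N%:R) 0.
Proof.
move=> mu0 muP n.
(* The product charges the factor [a [j]_{p,q}] of each [lcoef] to the rising step and leaves [b
   [j]_{v,w}] to the falling one, without any division. *)
suff H k : Lfun mu ('X^n * P k) =
    iter n path_step (fun k => (k == 0)%N%:R) k * \prod_(j < k) (a * qint p q j.+1).
  by have := H 0%N; rewrite /P /opoly /= big_ord0 !mulr1 Lfun_Xn.
elim: n k => [|n IH] k.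
  rewrite expr0 mul1r /=; case: k => [|k]; last by rewrite muP // mul0r.
  by rewrite big_ord0 mulr1 /P /opoly /= -(expr0 'X) Lfun_Xn.
rewrite exprSr -mulrA opoly_mulX !mulrDr.
have swap (c : R) (Q : {poly R}) : 'X^n * (c%:P * Q) = c%:P * ('X^n * Q) by rewrite mulrCA.
rewrite !swap !LfunD !LfunC !IH iterS /path_step big_ord_recr /=.
case: k => [|k] /=; first by rewrite /lcoef !qint0; ring.
by rewrite big_ord_recr /= /lcoef /bc; ring.
Qed.

End Moments.

(** * Weights of marked words *)

(* [(first, x, top)]: a letter [x], whether it starts its block, and the letter
   that follows it in its block, taken to be a large [N] if the block is open at
   [x]. At a closed end of a block [top] is junk below [x]. *)
Definition bletter : Type := (bool * nat * nat)%type.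

Definition straddle (c : nat) (e : bletter) : bool := (e.1.2 < c < e.2)%N.

Definition nstraddle (c : nat) (z : seq bletter) : nat := count (straddle c) z.
Arguments nstraddle : simpl never.

Lemma nstraddle_cons c e z : nstraddle c (e :: z) = (straddle c e + nstraddle c z)%N.
Proof. by []. Qed.

Lemma nstraddle_cat c z1 z2 :
  nstraddle c (z1 ++ z2) = (nstraddle c z1 + nstraddle c z2)%N.
Proof. exact: count_cat. Qed.

(** A marked letter ends its block for now, even if the next letter is larger. With the default 0
    for [next], an unmarked last letter also ends its block. *)
Fixpoint blocks (N : nat) (first : bool) (y : mword) : seq bletter :=
  if y is e :: y' then
    let next := head 0%N (unzip1 y') in
    (first, e.1, if e.2 then N else next) ::
      blocks N (e.2 || (next < e.1)%N) y'
  else [::].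

Definition below (i : nat) (z : seq bletter) := all (fun e => (e.1.2 < i)%N) z.

Lemma below_blocks i N f y :
  below i (blocks N f y) = all (fun c => (c < i)%N) (unzip1 y).
Proof. by rewrite /below; elim: y f => //= e y IH f; rewrite IH. Qed.

(** The [top] of an unmarked letter is 0 or a letter below [i], so it cannot straddle [i]; a marked
    one has [top = N] and does. *)
Lemma nstraddle_blocks i N f (y : mword) :
  (i < N)%N -> all (fun c => (c < i)%N) (unzip1 y) ->
  nstraddle i (blocks N f y) = nmarks y.
Proof.
move=> ltiN; elim: y f => //= -[c m] y IH f /= /andP[ci hy].
rewrite nstraddle_cons IH // /straddle ci /=; congr (nat_of_bool _ + _)%N.
case: m => //=.
by case: y hy {IH} => [|[d k] y] //= /andP[di _]; rewrite ltnNge ltnW.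
Qed.

(** [blocks] looks only one letter ahead, so the part before [c] reads the same for every mark on
    [c] and every continuation. This makes the words before and after an insertion comparable. *)
Lemma blocks_cat i N f (y1 : mword) c : (i < N)%N -> (c < i)%N ->
  all (fun d => (d < i)%N) (unzip1 y1) ->
  exists z1 f1, [/\ below i z1, nstraddle i z1 = nmarks y1 &
    forall m y2, blocks N f (y1 ++ (c, m) :: y2) = z1 ++ blocks N f1 ((c, m) :: y2)].
Proof.
move=> ltiN ci; elim: y1 f => [|[d k] y1 IH] f /=.
  by move=> _; exists [::], f.
move=> /andP[di hy1].
have hd m y2 : head 0%N (unzip1 (y1 ++ (c, m) :: y2)) = head c (unzip1 y1).
  by case: (y1).
have [z1 [f1 [bz1 nz1 hz1]]] := IH (k || (head c (unzip1 y1) < d))%N hy1.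
exists ((f, d, if k then N else head c (unzip1 y1)) :: z1), f1; split => /=.
- by rewrite di.
- rewrite nstraddle_cons nz1 /straddle /= di /=; congr (nat_of_bool _ + _)%N.
  case: k {hz1 nz1 IH} => //.
  suff /ltnW : (head c (unzip1 y1) < i)%N by rewrite ltnNge => ->.
  by case: (y1) hy1 => //= ? ? /andP[].
- by move=> m y2; rewrite hd hz1.
Qed.

Section Weight.
Variables (R : comNzRingType) (a b r s t u p q v w : R).

(** [asc] tells that the block goes on after the letter; the four cases are opener, singleton,
    continuator, closer. *)
Definition letter_weight (first asc : bool) (l k : nat) : R :=
  if first then a * (if asc then p ^+ l * q ^+ k else r ^+ l * s ^+ k)
  else b * (if asc then t ^+ l * u ^+ k else v ^+ l * w ^+ k).

Definition bweight (e : bletter) : nat -> nat -> R :=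
  letter_weight e.1.1 (e.1.2 < e.2)%N.

(* The product of the weights of the letters of [z], read in [z0 ++ z]. *)
Fixpoint block_weight (z0 z : seq bletter) : R :=
  if z is e :: z' then
    bweight e (nstraddle e.1.2 z0) (nstraddle e.1.2 z') * block_weight (rcons z0 e) z'
  else 1.

Lemma block_weight_ext i z0 z0' z : below i z ->
  (forall c, (c < i)%N -> nstraddle c z0 = nstraddle c z0') ->
  block_weight z0 z = block_weight z0' z.
Proof.
elim: z z0 z0' => //= e z IH z0 z0' /andP[ei bz] H.
rewrite H //; congr (_ * _); apply: IH => // c ci.
by rewrite -!cats1 !nstraddle_cat H.
Qed.

(** The new letter exceeds all those of [z1] and [z2], hence straddles none of them and leaves their
    weights unchanged. *)
Lemma block_weight_insert i z0 z1 z2 e : e.1.2 = i -> below i z1 -> below i z2 ->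
  block_weight z0 (z1 ++ e :: z2) =
  block_weight z0 (z1 ++ z2) * bweight e (nstraddle i (z0 ++ z1)) (nstraddle i z2).
Proof.
move=> ei; elim: z1 z0 => [|d z1 IH] z0 /= b1 b2.
  rewrite cats0 ei mulrC; congr (_ * _); apply: (@block_weight_ext i) => // c ci.
  rewrite -cats1 nstraddle_cat nstraddle_cons /straddle ei.
  by rewrite [(i < c)%N]ltnNge ltnW // addn0.
case/andP: b1 => di b1; rewrite IH // cat_rcons mulrA.
congr (bweight _ _ _ * _ * _); rewrite !nstraddle_cat nstraddle_cons.
by rewrite /straddle ei [(i < _)%N]ltnNge ltnW.
Qed.

(** Prolonging an open block by [i] lowers the [top] of its end from [N] to [i]. Capping at [i]
    erases this difference without altering the weights of letters below [i]. *)
Definition cap (i : nat) (e : bletter) : bletter := (e.1, minn e.2 i).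

Lemma nstraddle_cap i c z : (c < i)%N -> nstraddle c (map (cap i) z) = nstraddle c z.
Proof.
move=> ci; rewrite /nstraddle count_map; apply: eq_count => e.
by rewrite /straddle /= leq_min ci andbT.
Qed.

Lemma block_weight_cap i z0 z : below i z ->
  block_weight (map (cap i) z0) (map (cap i) z) = block_weight z0 z.
Proof.
elim: z z0 => //= e z IH z0 /andP[ei bz].
by rewrite !nstraddle_cap // /bweight /= leq_min ei andbT -map_rcons IH.
Qed.

Definition mword_weight (N : nat) (y : mword) : R := block_weight [::] (blocks N true y).

Lemma mword_weight_cons i N m y : (i < N)%N -> all (fun d => (d < i)%N) (unzip1 y) ->
  mword_weight N ((i, m) :: y) = mword_weight N y * letter_weight true m 0 (nmarks y).
Proof.
move=> ltiN hy.
(* The letter after [i] is smaller than [i], so it still starts a block. *)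
have E : blocks N (m || (head 0%N (unzip1 y) < i)%N) y = blocks N true y.
  by case: y hy => //= -[d k] y /andP[/= -> _]; rewrite orbT.
rewrite /mword_weight -[blocks N true (_ :: y)]/([::] ++ (true, i, _) :: blocks N _ y) E.
rewrite (@block_weight_insert i) ?below_blocks //.
rewrite nstraddle_blocks // /bweight /=; congr (_ * letter_weight true _ 0 _).
case: m {E}; first by rewrite ltiN.
by case: y hy => [|[d k] y] //= /andP[di _]; rewrite ltnNge ltnW.
Qed.

(** If [m] is true, the block of [c] stays open and straddles [i] from the left, whence the summand
    [m]; if [m] is false, [i] belongs to that block, which does not count. *)
Lemma mword_weight_insert i N m m' c y1 y2 : (i < N)%N ->
  all (fun d => (d < i)%N) (unzip1 (y1 ++ (c, true) :: y2)) ->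
  mword_weight N (y1 ++ (c, m) :: (i, m') :: y2) =
  mword_weight N (y1 ++ (c, true) :: y2) *
    letter_weight m m' (nmarks y1 + m) (nmarks y2).
Proof.
move=> ltiN; rewrite /unzip1 map_cat all_cat /= => /and3P[hy1 ci hy2].
have [z1 [f1 [bz1 nz1 hz1]]] := blocks_cat i N true y1 c ltiN ci hy1.
have E : blocks N (m' || (head 0%N (unzip1 y2) < i)%N) y2 = blocks N true y2.
  by case: y2 hy2 => //= -[d k] y2 /andP[/= -> _]; rewrite orbT.
rewrite /mword_weight !hz1 /= E -[in LHS]cat_rcons -[in RHS]cat_rcons.
have bz m0 : below i (rcons z1 (f1, c, m0)) by rewrite /below all_rcons /= ci.
rewrite [in LHS](@block_weight_insert i) ?below_blocks //= nstraddle_blocks //.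
congr (_ * _).
  rewrite -(@block_weight_cap i) ?/below ?all_cat; last first.
    by apply/andP; split; [exact: bz | rewrite -/(below _ _) below_blocks].
  rewrite -[in RHS](@block_weight_cap i) ?/below ?all_cat; last first.
    by apply/andP; split; [exact: bz | rewrite -/(below _ _) below_blocks].
  congr block_weight; rewrite !map_cat !map_rcons; congr (rcons _ _ ++ _).
  rewrite /cap /=; congr (_, _); case: m {bz} => //.
  by rewrite minnn (minn_idPr (ltnW ltiN)).
rewrite /bweight /= (ltnNge i c) (ltnW ci) orbF; congr letter_weight.
- case: m' {E}; first by rewrite ltiN.
  by case: y2 hy2 => [|[d k] y2] //= /andP[di _]; rewrite ltnNge ltnW.
- rewrite -cats1 nstraddle_cat nz1 nstraddle_cons addn0.
  by rewrite /straddle /= ci; case: m {bz}; rewrite ?ltiN ?ltnn.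
Qed.

(** The prefix [y0] is already scanned, and [j] counts the marks before the one being used. A new
    block also has the used open block on its left, hence [j.+1] in the first two terms. *)
Lemma sum_insert_after_mark (y0 y : mword) i N (H : nat -> R) : (i < N)%N ->
  all (fun d => (d < i)%N) (unzip1 (y0 ++ y)) ->
  \sum_(y' <- insert_after_mark i y) mword_weight N (y0 ++ y') * H (nmarks (y0 ++ y')) =
  mword_weight N (y0 ++ y) * \sum_(nmarks y0 <= j < nmarks (y0 ++ y))
   (letter_weight true true j.+1 (nmarks (y0 ++ y) - j.+1) * H (nmarks (y0 ++ y)).+1 +
    letter_weight true false j.+1 (nmarks (y0 ++ y) - j.+1) * H (nmarks (y0 ++ y)) +
    letter_weight false true j (nmarks (y0 ++ y) - j.+1) * H (nmarks (y0 ++ y)) +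
    letter_weight false false j (nmarks (y0 ++ y) - j.+1) * H (nmarks (y0 ++ y)).-1).
Proof.
move=> ltiN; elim: y y0 => [|[c m] y IH] y0 hy.
  by rewrite /= big_nil cats0 big_geq ?mulr0.
have E (F : mword -> R) :
  \sum_(y' <- map (cons (c, m)) (insert_after_mark i y)) F (y0 ++ y') =
  \sum_(y' <- insert_after_mark i y) F (rcons y0 (c, m) ++ y').
  by rewrite big_map; apply: eq_bigr => z _; rewrite cat_rcons.
rewrite /= big_cat /= (E (fun z => mword_weight N z * H (nmarks z))) {E}.
rewrite IH ?cat_rcons //.
have -> : nmarks (rcons y0 (c, m)) = (nmarks y0 + m)%N.
  by rewrite /nmarks -cats1 count_cat /= addn0.
case: m hy => hy /=; last by rewrite big_nil add0r addn0.
rewrite !big_cons big_nil addr0 !mword_weight_insert //.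
have hk : nmarks (y0 ++ (c, true) :: y) = (nmarks y0 + (nmarks y).+1)%N.
  by rewrite /nmarks count_cat.
rewrite [in RHS]big_ltn; last by rewrite hk; lia.
have hn m m' : nmarks (y0 ++ (c, m) :: (i, m') :: y) = (nmarks y0 + nmarks y + m + m')%N.
  by rewrite /nmarks count_cat /=; lia.
rewrite !hn addn1 addn0 mulrDr; congr (_ + _).
rewrite hk -!mulrA -!mulrDr; congr (_ * _).
rewrite (_ : nmarks y0 + (nmarks y).+1 - (nmarks y0).+1 = nmarks y)%N; last by lia.
rewrite (_ : (nmarks y0 + (nmarks y).+1).-1 = nmarks y0 + nmarks y)%N; last by lia.
by rewrite /= !addn0 !addn1 !addnS; ring.
Qed.

Lemma qint_rev (x y : R) k : \sum_(j < k) x ^+ j * y ^+ (k - j.+1) = qint x y k.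
Proof.
rewrite /qint (reindex_inj rev_ord_inj); apply: eq_bigr => j _ /=.
by congr (_ ^+ _ * _ ^+ _); have := ltn_ord j; lia.
Qed.

Lemma sum_insertions i N (y : mword) (H : nat -> R) : (i < N)%N ->
  all (fun d => (d < i)%N) (unzip1 y) ->
  \sum_(y' <- insertions i y) mword_weight N y' * H (nmarks y') =
  mword_weight N y * path_step R a b r s t u p q v w H (nmarks y).
Proof.
move=> ltiN hy; rewrite /insertions !big_cons !mword_weight_cons //.
rewrite (@sum_insert_after_mark [::]) //= big_mkord -!mulrA -!mulrDr.
congr (_ * _); set k := nmarks y.
rewrite !big_split /= -!mulr_suml -/(nmarks y) -/k.
(* New blocks behind open ones give the left exponents 1 to [k]; the front insertion supplies the
   missing exponent 0, completing [[k+1]]. *)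
have first_ge x y1 : \sum_(j < k) a * (x ^+ j.+1 * y1 ^+ (k - j.+1)) =
    a * (qint x y1 k.+1 - y1 ^+ k).
  rewrite -mulr_sumr -qint_rev big_ord_recl /= expr0 mul1r subn1 /=.
  rewrite [X in X - _]addrC addrK; congr (_ * _); exact: eq_bigr.
rewrite /letter_weight !first_ge -!mulr_sumr !qint_rev !add0n !expr0 !mul1r.
by rewrite /path_step /bcoef add1n; ring.
Qed.

Lemma sum_mwords n N (H : nat -> R) : (n <= N)%N ->
  \sum_(y <- mwords n) mword_weight N y * H (nmarks y) =
  iter n (path_step R a b r s t u p q v w) H 0%N.
Proof.
elim: n H => [|n IH] H leN.
  by rewrite /= big_seq1 /mword_weight /= mul1r.
(* The last insertion is the last step of the path: it replaces the final weight [H] by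
   [path_step H]. *)
rewrite iterSr -IH ?(ltnW leN) // big_flatten big_map.
rewrite [LHS]big_seq [RHS]big_seq; apply: eq_bigr => y.
rewrite mem_mwords map_id => hy; rewrite sum_insertions //.
by apply/allP => c; rewrite (perm_mem hy) mem_iota add0n.
Qed.

End Weight.

(** * Permutations *)

Definition closed_mword (x : seq nat) : mword := [seq (c, false) | c <- x].

Lemma unzip1_closed_mword x : unzip1 (closed_mword x) = x.
Proof. by rewrite /unzip1 -map_comp map_id. Qed.

Lemma closed_mwordK (y : mword) : nmarks y = 0%N -> closed_mword (unzip1 y) = y.
Proof. by elim: y => //= -[c [|]] y IH //= h; rewrite IH. Qed.

Lemma size_blocks N f (y : mword) : size (blocks N f y) = size y.
Proof. by elim: y f => //= e y IH f; rewrite IH. Qed.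

Lemma nth_blocks_closed N f x j e0 : (j < size x)%N ->
  nth e0 (blocks N f (closed_mword x)) j =
  (if j is j'.+1 then (nth 0%N x j < nth 0%N x j')%N else f, nth 0%N x j, nth 0%N x j.+1).
Proof.
elim: x f j => //= c x IH f [|j] jx; rewrite unzip1_closed_mword; first by rewrite nth0.
by rewrite /= IH //; case: j jx => //=; rewrite nth0.
Qed.

Section BlockWeight.
Variables (R : comNzRingType) (a b r s t u p q v w : R).

Lemma block_weight_prod e0 z0 z :
  block_weight R a b r s t u p q v w z0 z =
  \prod_(j < size z) bweight R a b r s t u p q v w (nth e0 z j)
    (nstraddle (nth e0 z j).1.2 (z0 ++ take j z))
    (nstraddle (nth e0 z j).1.2 (drop j.+1 z)).
Proof.
elim: z z0 => [|e z IH] z0 /=; first by rewrite big_ord0.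
rewrite big_ord_recl /= cats0 drop0 IH; congr (_ * _).
by apply: eq_bigr => j _ /=; rewrite cat_rcons.
Qed.

End BlockWeight.

Section WordWeight.
Variables (R : comNzRingType) (a b r s t u p q v w : R).

Lemma nstraddle_blocks_closed N x c i k : (i + k <= size x)%N ->
  nstraddle c (take k (drop i (blocks N true (closed_mword x)))) =
  count (crossing x c) (iota i k).
Proof.
move=> ik; rewrite -(@map_nth_iota _ (true, 0, 0)%N) ?size_blocks ?size_map; last by lia.
rewrite /nstraddle count_map; apply: eq_in_count => l; rewrite mem_iota => hl /=.
by rewrite nth_blocks_closed //; lia.
Qed.

(** Without marks the blocks are the runs and each [top] is the next letter, so straddling letters
    are crossings, which [lsg] and [rsg] count. *)
Lemma mword_weight_closed N x : uniq x ->
  mword_weight R a b r s t u p q v w N (closed_mword x) =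
  \prod_(j < size x) letter_weight R a b r s t u p q v w
    (rstart x j) (~~ rend x j) (lsg x j) (rsg x j).
Proof.
move=> ux; set e0 : bletter := (true, 0, 0)%N.
rewrite /mword_weight (block_weight_prod _ _ _ _ _ _ _ _ _ _ _ e0).
rewrite size_blocks size_map; apply: eq_bigr => -[j jx] _ /=; set z := blocks N true (closed_mword x).
have sz : size z = size x by rewrite size_blocks size_map.
have nz : nth e0 z j = (rstart x j, nth 0%N x j, nth 0%N x j.+1).
  by rewrite nth_blocks_closed //; case: (j).
rewrite /bweight nz /=; congr letter_weight.
- rewrite /rend negb_or; have [jl|jl] := eqVneq j.+1 (size x).
    by rewrite [nth _ _ j.+1]nth_default ?jl.
  have j1x : (j.+1 < size x)%N by rewrite ltn_neqAle jl.
  by rewrite -leqNgt [RHS]leq_eqVlt nth_uniq // ltn_eqF.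
- rewrite lsg_crossings // -[z]drop0 nstraddle_blocks_closed ?add0n 1?ltnW //.
  rewrite /positions -[size x](subnKC (ltnW jx)) iotaD count_cat.
  rewrite [X in (_ + X)%N](@eq_in_count _ _ pred0) ?count_pred0 ?addn0.
    by apply: eq_in_count => l; rewrite mem_iota /= => ->.
  by move=> l; rewrite mem_iota => hl /=; rewrite ltnNge (proj1 (andP hl)).
- rewrite rsg_crossings // -[drop _ z]take_size size_drop sz.
  rewrite nstraddle_blocks_closed ?subnKC //.
  rewrite /positions -[X in iota 0 X](subnKC jx) iotaD count_cat.
  rewrite [X in (X + _)%N](@eq_in_count _ _ pred0) ?count_pred0 ?add0n.
    by apply: eq_in_count => l; rewrite mem_iota => /andP[/= -> _].
  by move=> l; rewrite mem_iota /= ltnS => hl; rewrite ltnNge hl.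
Qed.

Lemma mword_weight_word n N (sg : 'S_n) :
  mword_weight R a b r s t u p q v w N (closed_mword (word sg)) =
  weight a b r s t u p q v w sg.
Proof.
have ux : uniq (word sg).
  by rewrite map_inj_uniq ?enum_uniq // => i j /val_inj /perm_inj.
have sx : size (word sg) = n by rewrite size_map size_enum_ord.
rewrite mword_weight_closed // /weight; set x := word sg in ux sx *.
have posE : positions x = index_iota 0 (size x) by rewrite /index_iota subn0.
have prodX (y : R) (f : nat -> nat) (X : pred nat) :
    y ^+ sumn [seq f j | j <- positions x & X j] =
    \prod_(j < size x) (if X j then y ^+ f j else 1).
  rewrite sumnE big_map big_filter expr_sum big_mkcond posE.
  by rewrite big_mkord.
have prod1 (y : R) (X : pred nat) :
    y ^+ count X (positions x) = \prod_(j < size x) (if X j then y else 1).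
  rewrite -sum1_count expr_sum big_mkcond posE.
  by rewrite big_mkord.
have -> : (n - nruns x = count (predC (rstart x)) (positions x))%N.
  rewrite /nruns; have := count_predC (rstart x) (positions x).
  by rewrite size_iota sx; lia.
rewrite /nruns !prod1 /lsgX /rsgX !prodX -!big_split.
apply: eq_bigr => j _; rewrite /letter_weight /is_sing /is_cont /is_op /is_clos.
by case E: (rstart x j); case: (rend x j); rewrite /= ?E /=; ring.
Qed.

End WordWeight.

(** A word without marks is determined by its letters, which may come in any order. *)
Lemma perm_words n :
  perm_eq [seq unzip1 y | y <- mwords n & nmarks y == 0%N] [seq word sg | sg : 'S_n].
Proof.
apply: uniq_perm.
- rewrite map_inj_in_uniq ?filter_uniq ?uniq_mwords // => y y'.
  rewrite !mem_filter => /andP[/eqP hy _] /andP[/eqP hy' _] E.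
  by rewrite -(closed_mwordK y hy) E closed_mwordK.
- rewrite map_inj_uniq ?enum_uniq // => sg sg' E; apply/permP => i.
  have wn (g : 'S_n) : nth 0%N (word g) i = g i.
    by rewrite /word (nth_map i) ?size_enum_ord // nth_ord_enum.
  by apply: val_inj; rewrite /= -!wn E.
move=> x; apply/mapP/imageP => [[y + ->]|[sg _ ->]].
  rewrite mem_filter mem_mwords => /andP[_ hy].
  have /tuple_permP[sg hsg] : perm_eq (unzip1 y) (map_tuple val (ord_tuple n)).
    by rewrite /= val_enum_ord.
  exists sg => //; rewrite hsg; apply: eq_map => i.
  by rewrite tnth_map tnth_ord_tuple.
exists (closed_mword (word sg)); last by rewrite unzip1_closed_mword.
rewrite mem_filter mem_mwords unzip1_closed_mword; apply/andP; split.
  by rewrite /nmarks count_map count_pred0.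
rewrite -val_enum_ord.
have -> : word sg = map val (map sg (enum 'I_n)) by rewrite -map_comp.
apply: perm_map; apply: uniq_perm; rewrite ?enum_uniq //.
  by rewrite map_inj_uniq ?enum_uniq //; apply: perm_inj.
move=> i; rewrite mem_enum; apply/mapP; exists (sg^-1%g i); last by rewrite permKV.
by rewrite mem_enum.
Qed.

Theorem theorem1 (R : comNzRingType) (a b r s t u p q v w : R) (mu : nat -> R) :
  mu 0%N = 1 ->
  (forall n : nat, (0 < n)%N -> Lfun mu (opoly a b r s t u p q v w n) = 0) ->
  forall n : nat, mu n = \sum_(sg : 'S_n) weight a b r s t u p q v w sg.
Proof.
move=> mu0 muP n; rewrite (moment_paths _ _ _ _ _ _ _ _ _ _ _ mu mu0 muP).
rewrite -(sum_mwords _ _ _ _ _ _ _ _ _ _ _ n n) //.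
(* The indicator of height 0 keeps exactly the words whose blocks are all closed. *)
transitivity (\sum_(y <- mwords n | nmarks y == 0%N)
    mword_weight R a b r s t u p q v w n (closed_mword (unzip1 y))).
  rewrite [RHS]big_mkcond; apply: eq_bigr => y _.
  by case: eqP => [/closed_mwordK->|_]; rewrite ?mulr1 ?mulr0.
rewrite -big_filter -(big_map (@unzip1 _ _) xpredT
  (fun x => mword_weight R a b r s t u p q v w n (closed_mword x))).
rewrite (perm_big _ (perm_words n)) big_image.
by apply: eq_bigr => sg _; rewrite mword_weight_word.
Qed.
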